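(* Let $F\subset\{1,\dots,n\}$ be a strict subset and let $A=(A_1,\dots,A_n)\in\mathcal{A}_n^F$ be such that $\operatorname{zer}\sum_{i=1}^nA_i\neq\emptyset$ and $A_i$ is $\beta_i$-cocoercive (with $\beta_i>0$) for all $i\in F$. Let $B^\dagger\in\mathbb{R}^{n\times n}$ be the diagonal matrix with $B^\dagger_{i,i}=\beta_i^{-1}$ for $i\in F$ and all other entries zero. Let $T_{(\cdot)}\colon\mathcal{H}^d\to\mathcal{H}^d$ be a frugal splitting operator over $\mathcal{A}_n^F$ with representation $(p,SUP,SU,U,UP)$, where $p\in\{1,\dots,n\}\setminus F$, $U\in\mathbb{R}^{d\times d}$, $S\in\mathbb{R}^{n\times d}$, $P\in\mathbb{R}^{d\times n}$, $SUP$ is a $p$-kernel over $\mathcal{A}_n^F$, $\operatorname{ran}P\subseteq(\ker U)^\perp$ and $\ker S\supseteq(\operatorname{ran}U)^\perp$. Let $z_0\in\mathcal{H}^d$ and let $\{z_k\}_{k\in\mathbb{N}}$, $\{y_k\}_{k\in\mathbb{N}}$ be generated by $$y_k=(SUP+\Phi_{A,p})^{-1}SUz_k,\qquad z_{k+1}=z_k-U(z_k-Py_k),\qquad k\in\mathbb{N}.$$ Consider the following conditions on a symmetric matrix $Q\in\mathbb{R}^{d\times d}$: (a) $(I-I_F)(P^TQ-S)U=0$, (b) $Q\succ0$ and $W\succ0$, where $W=QU+(QU)^T-U^TQU-\tfrac12(P^TQU-SU)^TB^\dagger(P^TQU-SU)$, $I\in\mathbb{R}^{n\times n}$ is the identity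 matrix, and $I_F\in\mathbb{R}^{n\times n}$ is the diagonal matrix with $(I_F)_{i,i}=1$ if $i\in F$ and $(I_F)_{i,i}=0$ otherwise. If (a) holds, then $$\|z_{k+1}-P\bar y\|_Q^2\le\|z_k-P\bar y\|_Q^2-\|z_k-Py_k\|_W^2$$ for all $k\in\mathbb{N}$ and all $\bar y\in\operatorname{zer}\Phi_{A,p}$. If (b) also holds, then there exists $y^\star\in\operatorname{zer}\Phi_{A,p}$ such that, as $k\to\infty$, (i) $z_k-Py_k\to0$, (ii) $\Phi_{A,p}y_k\ni SU(z_k-Py_k)\to0$, (iii) $y_k\rightharpoonup y^\star$, (iv) $z_k\rightharpoonup Py^\star\in\operatorname{fix}T_A$.
   Context: Throughout, $\mathcal{H}$ is a real Hilbert space with $\dim\mathcal{H}\ge 2$, $\mathbb{N}=\{0,1,\dots\}$, and $n,d\in\mathbb{N}_+=\{1,2,\dots\}$. A set-valued operator $A\colon\mathcal{H}\to2^{\mathcal{H}}$ is called single-valued if $Ax$ is a singleton for every $x\in\mathcal{H}$, and is then identified with a map. $J_A=(\mathrm{Id}+A)^{-1}$ is the resolvent, $\operatorname{zer}A=\{x: 0\in Ax\}$, $\operatorname{fix}T=\{z:Tz=z\}$. An operator $A$ is $\beta$-cocoercive if it is single-valued and $\langle Ax-Ay,x-y\rangle\ge\beta\|Ax-Ay\|^2$ for all $x,y\in\mathcal{H}$. $\rightharpoonup$ denotes weak convergence and $\to$ strong convergence. Operator tuples: for $F\subseteq\{1,\dots,n\}$, $\mathcal{A}_n^F$ is the set of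 tuples $A=(A_1,\dots,A_n)$ where every $A_i\colon\mathcal{H}\to2^{\mathcal{H}}$ is maximally monotone and $A_i$ is single-valued for all $i\in F$. Parameterized operators: $T_{(\cdot)}\colon X\to Y$ parameterized by $\mathcal{A}_n^F$ means a map $T_A\colon X\to Y$ for each $A\in\mathcal{A}_n^F$. Matrices as operators: a matrix $B\in\mathbb{R}^{k\times m}$ acts on $z=(z_1,\dots,z_m)\in\mathcal{H}^m$ by $(Bz)_i=\sum_{j=1}^m B_{ij}z_j$, giving $Bz\in\mathcal{H}^k$. $\mathcal{H}^m$ carries the sum inner product, and for a symmetric matrix $H\in\mathbb{R}^{m\times m}$ we write $\|x\|_H^2=\langle Hx,x\rangle$ for $x\in\mathcal{H}^m$. Orthogonal complements of ranges and kernels of matrices are with respect to the standard Euclidean inner product. $\succ0$ means positive definite. Primal-dual operator: for $A\in\mathcal{A}_n^F$ and $p\in\{1,\dots,n\}$, $\Phi_{A,p}=\Delta_{A,p}+\Gamma_p\colon\mathcal{H}^n\to2^{\mathcal{H}^n}$, where $\Delta_{A,p}(y_1,\dots,y_n)=\widehat{A}_1y_1\times\dots\times\widehat{A}_ny_n$ with $\widehat{A}_p=A_p$ and $\widehat{A}_i=A_i^{-1}$ for $i\ne p$, and $\Gamma_p=R_p-R_p^T\in\mathbb{R}^{n\times n}$, where $R_p$ has ones on the $p$th row and zeros elsewhere. Frugal splitting operator: $T_{(\cdot)}\colon\mathcal{H}^d\to\mathcal{H}^d$ parameterized by $\mathcal{A}_n^F$ is a frugal splitting operator over $\mathcal{A}_n^F$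 if there exist $d_1,\dots,d_{n+1}\in\mathbb{N}_+$ with $d_1=d_{n+1}=d$ and, for each $i\in\{1,\dots,n\}$, an operator $\tau_{i,(\cdot)}\colon\mathcal{H}^{d_i}\to\mathcal{H}^{d_{i+1}}$ parameterized by $\mathcal{A}_n^F$ such that, for all $A\in\mathcal{A}_n^F$: (1) $\operatorname{fix}T_A\neq\emptyset\iff\operatorname{zer}\sum_{i=1}^nA_i\ne\emptyset$; (2) $T_A=\tau_{n,A}\circ\tau_{n-1,A}\circ\cdots\circ\tau_{1,A}$; and moreover for each $i$ there exist $B_i\in\mathbb{R}^{d_{i+1}\times d_i}$, $C_i\in\mathbb{R}^{d_{i+1}\times1}$, $D_i\in\mathbb{R}^{1\times d_i}$, $\gamma_i>0$ (independent of $A$) such that for all $A\in\mathcal{A}_n^F$ and $z_i\in\mathcal{H}^{d_i}$, $\tau_{i,A}z_i=B_iz_i+C_iJ_{\gamma_iA_i}(D_iz_i)$ if $i\notin F$ and $\tau_{i,A}z_i=B_iz_i+C_iA_i(D_iz_i)$ if $i\in F$. Representation: $T_{(\cdot)}\colon\mathcal{H}^d\to\mathcal{H}^d$ parameterized by $\mathcal{A}_n^F$ is a generalized primal-dual resolvent with representation $(p,M,N,U,V)$, where $p\in\{1,\dots,n\}$, $M\in\mathbb{R}^{n\times n}$, $N\in\mathbb{R}^{n\times d}$, $U\in\mathbb{R}^{d\times d}$, $V\in\mathbb{R}^{d\times n}$, if for all $A\in\mathcal{A}_n^F$ and all $z\in\mathcal{H}^d$, $(M+\Phi_{A,p})^{-1}\circ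 N$ is single-valued at $z$ and, with $y=(M+\Phi_{A,p})^{-1}Nz\in\mathcal{H}^n$, $T_Az=z-Uz+Vy$. In particular, the iteration in the claim is $z_{k+1}=T_Az_k$. $p$-kernel: $M\in\mathbb{R}^{n\times n}$ is a $p$-kernel over $\mathcal{A}_n^F$ if $p\notin F$, $M+\Gamma_p$ is lower triangular, $M_{i,i}\ge0$ for all $i\in\{1,\dots,n\}$, and $M_{i,i}=0$ if and only if $i\in F$. *)

(* Defs.v *)
From HB Require Import structures.
From mathcomp Require Import all_boot all_order all_algebra.
From mathcomp Require Import all_classical all_reals all_analysis.
Set Implicit Arguments.
Unset Strict Implicit.
Unset Printing Implicit Defensive.
Import Order.TTheory GRing.Theory Num.Theory numFieldNormedType.Exports.
Local Open Scope classical_set_scope.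
Local Open Scope ring_scope.

(* Indices 1..n of the mathematical text are the elements 0..n-1 of 'I_n. *)

Definition ran_mx (R : realType) (k m : nat) (B : 'M[R]_(k, m)) : set 'cV[R]_k :=
  range (fun x : 'cV[R]_m => B *m x).

Definition ker_mx (R : realType) (k m : nat) (B : 'M[R]_(k, m)) : set 'cV[R]_m :=
  [set x | B *m x = 0].

Definition orth_compl (R : realType) (m : nat) (E : set 'cV[R]_m) : set 'cV[R]_m :=
  [set x | forall y, E y -> (x^T *m y) ord0 ord0 = 0].

Definition posdef (R : realType) (m : nat) (Q : 'M[R]_m) : Prop :=
  Q^T = Q /\
  forall x : 'cV[R]_m, x != 0 -> 0 < (x^T *m (Q *m x)) ord0 ord0.

Definition indic_mx (R : realType) (n : nat) (F : {set 'I_n}) : 'M[R]_n :=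
  diag_mx (\row_i (if i \in F then 1 else 0)).

Definition Bdagger (R : realType) (n : nat) (F : {set 'I_n}) (beta : 'I_n -> R)
    : 'M[R]_n :=
  diag_mx (\row_i (if i \in F then (beta i)^-1 else 0)).

Definition row_ones (R : realType) (n : nat) (p : 'I_n) : 'M[R]_n :=
  \matrix_(i, j) (if i == p then 1 else 0).

Definition Gamma_mx (R : realType) (n : nat) (p : 'I_n) : 'M[R]_n :=
  row_ones R p - (row_ones R p)^T.

Definition p_kernel (R : realType) (n : nat) (F : {set 'I_n}) (p : 'I_n)
    (M : 'M[R]_n) : Prop :=
  [/\ p \notin F,
      is_trig_mx (M + Gamma_mx R p) (* is_trig_mx: lower triangular *),
      forall i, 0 <= M i i
    & forall i, M i i = 0 <-> i \in F].

Definition mxact (R : realType) (H : lmodType R) (k m : nat)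
    (B : 'M[R]_(k, m)) (z : 'I_m -> H) : 'I_k -> H :=
  fun i => \sum_(j < m) B i j *: z j.

Section Operators.
Context {R : realType} {H : completeNormedModType R}.

(* The norm of the complete normed space H is the one induced by ip, which
   makes (H, ip) a real Hilbert space. *)
Definition hilbert_inner (ip : {dot H for idfun}) : Prop :=
  forall x : H, `|x| ^+ 2 = ip x x.

Definition dim_ge2 : Prop :=
  exists u v : H, forall a b : R, a *: u + b *: v = 0 -> a = 0 /\ b = 0.

Definition single_valued (X Y : Type) (A : X -> set Y) : Prop :=
  forall x, exists u, A x = [set u].

Definition op_of_fun (X Y : Type) (f : X -> Y) : X -> set Y :=
  fun x => [set f x].

Definition op_inv (X Y : Type) (A : X -> set Y) : Y -> set X :=
  fun u => [set x | A x u].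

Definition op_add (X : Type) (V : zmodType) (A B : X -> set V) : X -> set V :=
  fun x => [set u + v | u in A x & v in B x].

Definition op_scale (X : Type) (V : lmodType R) (g : R) (A : X -> set V)
    : X -> set V :=
  fun x => [set g *: u | u in A x].

Definition op_sum (n : nat) (A : 'I_n -> H -> set H) : H -> set H :=
  fun x => [set \sum_(i < n) u i | u in [set u : 'I_n -> H | forall i, A i x (u i)]].

Definition zer (X : Type) (V : zmodType) (A : X -> set V) : set X :=
  [set x | A x 0].

Definition fixpts (X : Type) (T : X -> X) : set X := [set z | T z = z].

Definition resolvent (A : H -> set H) : H -> set H :=
  op_inv (op_add (op_of_fun id) A).

Variable ip : {dot H for idfun}.

Definition monotone_op (A : H -> set H) : Prop :=
  forall x y u v, A x u -> A y v -> 0 <= ip (u - v) (x - y).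

Definition maximally_monotone (A : H -> set H) : Prop :=
  monotone_op A /\
  forall B : H -> set H, monotone_op B -> (forall x, A x `<=` B x) -> B = A.

Definition cocoercive (b : R) (A : H -> set H) : Prop :=
  single_valued A /\
  forall x y u v, A x u -> A y v -> b * `|u - v| ^+ 2 <= ip (u - v) (x - y).

Definition sum_ip (m : nat) (x y : 'I_m -> H) : R := \sum_(i < m) ip (x i) (y i).

Definition sum_norm (m : nat) (x : 'I_m -> H) : R := Num.sqrt (sum_ip x x).

Definition wnorm2 (m : nat) (W : 'M[R]_m) (x : 'I_m -> H) : R :=
  sum_ip (mxact W x) x.

Definition strong_cvg (m : nat) (x : nat -> 'I_m -> H) (l : 'I_m -> H) : Prop :=
  (fun k => sum_norm (x k - l)) @ \oo --> (0 : R).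

Definition weak_cvg (m : nat) (x : nat -> 'I_m -> H) (l : 'I_m -> H) : Prop :=
  forall w : 'I_m -> H, (fun k => sum_ip (x k) w) @ \oo --> sum_ip l w.

Record op_tuple (n : nat) (F : {set 'I_n}) := OpTuple {
  ops :> 'I_n -> H -> set H;
  ops_maximal : forall i, maximally_monotone (ops i);
  ops_single : forall i, i \in F -> single_valued (ops i) }.

Definition primal_dual_part (n : nat) (A : 'I_n -> H -> set H) (p i : 'I_n)
    : H -> set H :=
  if i == p then A i else op_inv (A i).

Definition Delta_op (n : nat) (A : 'I_n -> H -> set H) (p : 'I_n)
    : ('I_n -> H) -> set ('I_n -> H) :=
  fun y => [set v | forall i, primal_dual_part A p i (y i) (v i)].

Definition Phi_op (n : nat) (A : 'I_n -> H -> set H) (p : 'I_n)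
    : ('I_n -> H) -> set ('I_n -> H) :=
  op_add (Delta_op A p) (op_of_fun (mxact (Gamma_mx R p))).

(* (M + Phi_{A,p})^{-1} *)
Definition pd_resolvent (n : nat) (A : 'I_n -> H -> set H) (p : 'I_n)
    (M : 'M[R]_n) : ('I_n -> H) -> set ('I_n -> H) :=
  op_inv (op_add (op_of_fun (mxact M)) (Phi_op A p)).

Definition has_representation (n d : nat) (F : {set 'I_n})
    (T : op_tuple F -> ('I_d -> H) -> ('I_d -> H))
    (p : 'I_n) (M : 'M[R]_n) (N : 'M[R]_(n, d))
    (U : 'M[R]_d) (V : 'M[R]_(d, n)) : Prop :=
  forall (A : op_tuple F) (z : 'I_d -> H),
    exists2 y, pd_resolvent A p M (mxact N z) = [set y]
             & T A z = z - mxact U z + mxact V y.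

(* The composition tau_(k-1) \o ... \o tau_0. *)
Fixpoint comp_upto (ds : nat -> nat)
    (tau : forall k, ('I_(ds k) -> H) -> ('I_(ds k.+1) -> H)) (k : nat)
    : ('I_(ds 0%N) -> H) -> ('I_(ds k) -> H) :=
  if k is j.+1 then fun z => tau j (@comp_upto ds tau j z) else id.
Arguments comp_upto {ds} tau k z.

(* The i-th factor of a frugal splitting operator: one evaluation of A_i, or of
   its resolvent. H^1 is identified with H on both sides of the evaluation. *)
Definition frugal_step (n : nat) (F : {set 'I_n}) (i : 'I_n) (a b : nat)
    (tau : op_tuple F -> ('I_a -> H) -> ('I_b -> H)) : Prop :=
  exists (B : 'M[R]_(b, a)) (C : 'M[R]_(b, 1)) (D : 'M[R]_(1, a)) (gamma : R),
    0 < gamma /\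
    forall (A : op_tuple F) (z : 'I_a -> H),
      exists2 u : H,
        (if i \in F then A i else resolvent (op_scale gamma (A i)))
          (mxact D z ord0) = [set u]
      & tau A z = mxact B z + mxact C (fun=> u).

(* The dimensions d_1, ..., d_{n+1} are ds 0, ..., ds n; the values of ds and
   tau at other indices are irrelevant. The cast_ord's only identify H^d with
   H^(ds 0) and H^(ds n). *)
Definition frugal_splitting (n d : nat) (F : {set 'I_n})
    (T : op_tuple F -> ('I_d -> H) -> ('I_d -> H)) : Prop :=
  exists (ds : nat -> nat) (d_first : ds 0%N = d) (d_last : ds n = d)
    (tau : forall k, op_tuple F -> ('I_(ds k) -> H) -> ('I_(ds k.+1) -> H)),
  [/\ forall k, (k <= n)%N -> (0 < ds k)%N,
      forall A : op_tuple F, fixpts (T A) !=set0 <-> zer (op_sum A) !=set0,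
      forall (A : op_tuple F) (z : 'I_d -> H),
        T A z = fun i => comp_upto (fun k => tau k A) n
                           (fun j => z (cast_ord d_first j))
                           (cast_ord (esym d_last) i)
    & forall i : 'I_n, frugal_step i (tau i)].

End Operators.

Arguments dim_ge2 {R} H.

(* Main.v *)
From HB Require Import structures.
Require Import Defs.
From mathcomp Require Import all_boot all_order all_algebra.
From mathcomp Require Import all_classical all_reals all_analysis.
From mathcomp Require Import ring lra.
Set Implicit Arguments.
Unset Strict Implicit.
Unset Printing Implicit Defensive.
Import Order.TTheory GRing.Theory Num.Theory numFieldNormedType.Exports.
Local Open Scope classical_set_scope.
Local Open Scope ring_scope.

(** The iteration is a descent method for the distance to [P ybar] in the metric
    [Q]. Write [x = z - P y]. The definition of [y] says that [S U x] is a value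
    of the primal-dual operator [Phi] at [y], and [Phi] is monotone, even
    strongly monotone in the coordinates of [F], because its skew part is
    invisible to monotonicity and the inverse of a cocoercive operator is
    strongly monotone. The hypothesis on [P^T Q - S] says that [P^T Q U] and
    [S U] differ only in the rows of [F]; the product of this difference with
    [y - ybar] is absorbed there by Young's inequality, and what remains is the
    weight [W]. This is [fejer_step].

    When [Q] and [W] are positive definite, their factorizations [C^T C] compare
    the weighted norms with the standard one ([posdef_coercive]). Hence [z] is
    bounded and [x] tends to [0], which gives the two strong limits. Forward
    substitution in the lower triangular system that defines [y], with a
    Lipschitz estimate for each row, shows that [y] is bounded too
    ([pd_resolvent_bounded]).

    Weak convergence is obtained along ultrafilters instead of subsequences.
    Along an ultrafilter every bounded scalar sequence converges, so that the
    Riesz representation theorem provides a weak limit of [y]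
    ([ultra_weak_cvg]). The limit is a zero of [Phi] since [Phi] is maximally
    monotone and its values [S U x] tend to [0] ([weak_limit_zer]). Two such
    limits [a] and [b] have [P a = P b], because the distances of [z] to [P a]
    and to [P b] both converge ([opial_unique]), and then [a = b] because both
    are the value of the single-valued resolvent at [P a]. As all ultrafilters
    give the same limit, the sequences themselves converge weakly ([cvg_ultra]);
    the same value of the resolvent shows that [P a] is a fixed point. *)

(** * Real inner products and the action of matrices on tuples *)

Section RealDot.
Variables (R : realType) (V : lmodType R) (f : {dot V for idfun}).

Lemma dotC u v : f u v = f v u.
Proof.
by have := @hermitian_subproof _ _ _ _ f u v; rewrite expr0 mul1r.
Qed.

Lemma dot0l v : f 0 v = 0. Proof. exact: linear0l. Qed.
Lemma dot0r u : f u 0 = 0. Proof. exact: linear0r. Qed.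
Lemma dotDl u v w : f (u + v) w = f u w + f v w. Proof. exact: linearDl. Qed.
Lemma dotDr u v w : f u (v + w) = f u v + f u w. Proof. exact: linearDr. Qed.
Lemma dotBl u v w : f (u - v) w = f u w - f v w. Proof. exact: linearBl. Qed.
Lemma dotBr u v w : f u (v - w) = f u v - f u w. Proof. exact: linearBr. Qed.
Lemma dotNl u v : f (- u) v = - f u v. Proof. exact: linearNl. Qed.
Lemma dotNr u v : f u (- v) = - f u v. Proof. exact: linearNr. Qed.

Lemma dot_suml I (r : seq I) (P : pred I) (E : I -> V) v :
  f (\sum_(i <- r | P i) E i) v = \sum_(i <- r | P i) f (E i) v.
Proof. exact: linear_sumlz. Qed.

Lemma dot_sumr I (r : seq I) (P : pred I) (E : I -> V) u :
  f u (\sum_(i <- r | P i) E i) = \sum_(i <- r | P i) f u (E i).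
Proof. exact: linear_sumr. Qed.

Lemma dot_ge0 u : 0 <= f u u.
Proof.
have [->|/neq0_dnorm_gt0 -/(_ idfun f)/ltW//] := eqVneq u 0.
by rewrite dot0r.
Qed.

Lemma dot_eq0 u : f u u = 0 -> u = 0.
Proof.
have [//|/neq0_dnorm_gt0 -/(_ idfun f)] := eqVneq u 0.
by move=> /lt0r_neq0/eqP.
Qed.

Lemma dotZl a u v : f (a *: u) v = a * f u v.
Proof. by rewrite linearZl_LR. Qed.

Lemma dotZr a u v : f u (a *: v) = a * f u v.
Proof. by rewrite linearZr_LR. Qed.

Lemma dot_sqrB u v : f (u - v) (u - v) = f u u - 2 * f u v + f v v.
Proof. rewrite dotBl !dotBr (dotC v u). ring. Qed.

Lemma dot_sqrD u v : f (u + v) (u + v) = f u u + 2 * f u v + f v v.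
Proof. rewrite dotDl !dotDr (dotC v u). ring. Qed.

(** Expand the square norm of [<v, v> u - <u, v> v], which is [<v, v>] times the
    difference of the two sides. *)
Lemma dot_cauchy_schwarz u v : (f u v) ^+ 2 <= f u u * f v v.
Proof.
have [->|/neq0_dnorm_gt0 -/(_ idfun f) v0] := eqVneq v 0.
  by rewrite !dot0r mulr0 expr0n.
have := dot_ge0 (f v v *: u - f u v *: v).
rewrite dot_sqrB !(dotZl, dotZr) => h.
have : 0 <= f v v * (f u u * f v v - f u v ^+ 2).
  by apply: le_trans h _; rewrite le_eqVlt; apply/orP; left; apply/eqP; ring.
by rewrite pmulr_rge0// subr_ge0.
Qed.

End RealDot.

Section MatrixAction.
Variables (R : realType) (V : lmodType R).

Lemma mxactE (k m : nat) (B : 'M[R]_(k, m)) (z : 'I_m -> V) i :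
  mxact B z i = \sum_(j < m) B i j *: z j.
Proof. by []. Qed.

(** Registered as a linear map so that [raddfB] and [raddf0] apply to the action of
    a fixed matrix. *)
Lemma mxact_linear (k m : nat) (B : 'M[R]_(k, m)) :
  linear (mxact B : ('I_m -> V) -> ('I_k -> V)).
Proof.
move=> a u v; apply/funext => i.
transitivity (a *: mxact B u i + mxact B v i) => //; rewrite !mxactE.
rewrite scaler_sumr -big_split/=; apply: eq_bigr => j _.
by rewrite [(a *: u + v) j]/(a *: u j + v j) scalerDr !scalerA mulrC.
Qed.

HB.instance Definition _ (k m : nat) (B : 'M[R]_(k, m)) :=
  GRing.isLinear.Build R ('I_m -> V) ('I_k -> V) *:%R (mxact B)
    (mxact_linear B).

Lemma mxactM (k l m : nat) (B : 'M[R]_(k, l)) (C : 'M[R]_(l, m)) (z : 'I_m -> V) :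
  mxact (B *m C) z = mxact B (mxact C z).
Proof.
apply/funext => i; rewrite !mxactE.
under eq_bigr do rewrite mxE scaler_suml.
rewrite exchange_big/=; apply: eq_bigr => j _.
by rewrite mxactE scaler_sumr; apply: eq_bigr => l' _; rewrite scalerA.
Qed.

Lemma mxact1 (m : nat) (z : 'I_m -> V) : mxact 1%:M z = z.
Proof.
apply/funext => i; rewrite mxactE (bigD1 i)//= mxE eqxx scale1r big1 ?addr0//.
by move=> j /negPf ji; rewrite mxE eq_sym ji scale0r.
Qed.

Lemma mxactDl (k m : nat) (B C : 'M[R]_(k, m)) (z : 'I_m -> V) :
  mxact (B + C) z = mxact B z + mxact C z.
Proof.
apply/funext => i.
transitivity (mxact B z i + mxact C z i) => //; rewrite !mxactE -big_split/=.
by apply: eq_bigr => j _; rewrite mxE scalerDl.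
Qed.

Lemma mxactZl (k m : nat) a (B : 'M[R]_(k, m)) (z : 'I_m -> V) :
  mxact (a *: B) z = a *: mxact B z.
Proof.
apply/funext => i; transitivity (a *: mxact B z i) => //; rewrite !mxactE scaler_sumr.
by apply: eq_bigr => j _; rewrite mxE scalerA.
Qed.

Lemma mxactBl (k m : nat) (B C : 'M[R]_(k, m)) (z : 'I_m -> V) :
  mxact (B - C) z = mxact B z - mxact C z.
Proof. by rewrite mxactDl -scaleN1r mxactZl scaleN1r. Qed.

End MatrixAction.

Section Tuples.
Variables (R : realType) (H : completeNormedModType R) (ip : {dot H for idfun}).

(** Together with the next two facts this makes the sum inner product a dot form
    on tuples, so that everything proved for inner products, Cauchy-Schwarz in
    particular, holds on [H] and on its powers at once. *)
Lemma sum_ip_bilinear (m : nat) :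
  bilinear_for (GRing.Scale.Law.clone _ _ *%R _)
    (GRing.Scale.Law.clone _ _ (idfun \; *%R) _) (@sum_ip R H ip m).
Proof.
split=> [u'|u] a x y; rewrite /sum_ip /= mulr_sumr -big_split/=;
  apply: eq_bigr => i _.
- by rewrite linearPl.
- by rewrite linearPr.
Qed.

HB.instance Definition _ (m : nat) :=
  bilinear_isBilinear.Build R ('I_m -> H) ('I_m -> H) R _ _ (@sum_ip R H ip m)
    (sum_ip_bilinear m).

Lemma sum_ip_hermitian (m : nat) (x y : 'I_m -> H) :
  sum_ip ip x y = (-1) ^+ false * idfun (sum_ip ip y x).
Proof. by rewrite expr0 mul1r; apply: eq_bigr => i _; exact: dotC. Qed.

HB.instance Definition _ (m : nat) :=
  isHermitianSesquilinear.Build R ('I_m -> H) false idfun (@sum_ip R H ip m)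
    (@sum_ip_hermitian m).

Lemma sum_ip_definite (m : nat) (x : 'I_m -> H) : x != 0 -> 0 < sum_ip ip x x.
Proof.
move=> x0; rewrite lt_neqAle sumr_ge0 ?andbT; last by move=> i _; exact: dot_ge0.
apply: contra x0; rewrite eq_sym psumr_eq0; last by move=> i _; exact: dot_ge0.
move=> /allP h; apply/eqP/funext => i.
by apply: (@dot_eq0 _ _ ip); apply/eqP; apply: h; rewrite mem_index_enum.
Qed.

HB.instance Definition _ (m : nat) :=
  isDotProduct.Build R ('I_m -> H) (@sum_ip R H ip m) (@sum_ip_definite m).

Lemma sum_ip_mxact (k m : nat) (B : 'M[R]_(k, m)) (x : 'I_m -> H) (y : 'I_k -> H) :
  sum_ip ip (mxact B x) y = sum_ip ip x (mxact B^T y).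
Proof.
rewrite /sum_ip; under eq_bigr do rewrite dot_suml.
rewrite exchange_big/=; apply: eq_bigr => j _; rewrite mxactE dot_sumr.
by apply: eq_bigr => i _; rewrite dotZl dotZr mxE.
Qed.

Lemma sum_ip_mxactr (k m : nat) (B : 'M[R]_(k, m)) (x : 'I_k -> H) (y : 'I_m -> H) :
  sum_ip ip x (mxact B y) = sum_ip ip (mxact B^T x) y.
Proof. by rewrite [RHS]sum_ip_mxact trmxK. Qed.

End Tuples.

(** * Positive definite weights *)

Section PositiveDefinite.
Variable R : realType.

(** Completing the square in the first coordinate: with first diagonal entry [a]
    and first row [a b], the form is [a (x0 + a^-1 b x')^2] plus the form of the
    Schur complement, which is again positive definite. A factorization, unlike a
    lower bound on real vectors, transfers at once to tuples of elements of [H]. *)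
Lemma posdef_cholesky (d : nat) (W : 'M[R]_d) :
  posdef W -> exists2 C : 'M[R]_d, C \in unitmx & W = C^T *m C.
Proof.
elim: d W => [|d IH] W [Wsym Wpos].
  by exists 1%:M; [exact: unitmx1 | rewrite [LHS]flatmx0 [RHS]flatmx0].
change 'M[R]_(1 + d)%N in W.
have {}Wpos (x : 'cV[R]_(1 + d)) : x != 0 -> 0 < (x^T *m (W *m x)) 0 0 := Wpos x.
pose a := W 0 0; pose b : 'rV[R]_d := ursubmx W.
have Wul : ulsubmx W = a%:M.
  by rewrite [LHS]mx11_scalar !mxE; congr (W _ _)%:M; apply/val_inj.
have Wdl : dlsubmx W = b^T by rewrite /b trmx_ursub Wsym.
have WE : W = block_mx a%:M b b^T (drsubmx W) by rewrite -Wul -Wdl submxK.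
have a_gt0 : 0 < a.
  have := Wpos (col_mx 1%:M 0); rewrite {1}WE mul_block_col tr_col_mx mul_row_col.
  rewrite !mulmx0 !mulmx1 trmx0 mul0mx !addr0 trmx1 mul1mx !mxE eqxx; apply.
  apply/eqP => /matrixP /(_ (lshift d 0) 0); rewrite col_mxEu !mxE eqxx.
  by move/eqP; rewrite oner_eq0.
have a_neq0 : a != 0 by rewrite gt_eqF.
pose S := drsubmx W - a^-1 *: (b^T *m b).
have Spos : posdef S.
  split=> [|v v0].
    by rewrite /S linearB/= linearZ/= trmx_mul trmxK trmx_drsub Wsym.
  (* the value of W at the minimizer of the first coordinate *)
  have := Wpos (col_mx (- (a^-1 *: (b *m v))) v).
  rewrite {1}WE mul_block_col tr_col_mx mul_row_col.
  have -> : a%:M *m - (a^-1 *: (b *m v)) + b *m v = 0.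
    by rewrite mul_scalar_mx scalerN scalerA divff// scale1r addNr.
  rewrite mulmx0 add0r.
  have -> : b^T *m - (a^-1 *: (b *m v)) + drsubmx W *m v = S *m v.
    by rewrite /S mulmxBl mulmxN -scalemxAr -scalemxAl mulmxA addrC.
  apply; apply: contra v0 => /eqP/matrixP h.
  by apply/eqP/matrixP => i j; have := h (rshift 1 i) j; rewrite col_mxEd !mxE.
have [C Cunit SE] := IH _ Spos.
pose s := Num.sqrt a.
have ss : s * s = a by rewrite -expr2 sqr_sqrtr// ltW.
have s_neq0 : s != 0 by rewrite gt_eqF// sqrtr_gt0.
pose K : 'M[R]_(1 + d) := block_mx s%:M (s^-1 *: b) 0 C.
have Kunit : K \in unitmx.
  by rewrite unitmxE det_ublock unitrM det_scalar1 unitfE s_neq0 -unitmxE.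
suff WK : W = K^T *m K by exists K.
rewrite /K tr_block_mx mulmx_block !trmx0 !mulmx0 !mul0mx !addr0.
rewrite tr_scalar_mx mul_scalar_mx scale_scalar_mx ss mul_scalar_mx scalerA.
rewrite divff// scale1r linearZ/= mul_mx_scalar scalerA divff// scale1r.
rewrite -scalemxAl -scalemxAr scalerA -invfM ss -SE /S addrC subrK.
exact: WE.
Qed.

Variables (H : completeNormedModType R) (ip : {dot H for idfun}).
Hypothesis H_hilbert : hilbert_inner ip.

Lemma norm_coord_le (m : nat) (x : 'I_m -> H) (i : 'I_m) :
  `|x i| <= sum_norm ip x.
Proof.
rewrite -(@ler_pXn2r _ 2)// ?nnegrE ?sqrtr_ge0// sqr_sqrtr ?dot_ge0//.
rewrite H_hilbert /sum_ip (bigD1 i)//= lerDl.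
by apply: sumr_ge0 => ? _; exact: dot_ge0.
Qed.

Lemma mxact_bounded (k m : nat) (B : 'M[R]_(k, m)) :
  exists2 c : R, 0 <= c & forall x : 'I_m -> H,
    sum_ip ip (mxact B x) (mxact B x) <= c * sum_ip ip x x.
Proof.
exists (\sum_(i < k) (\sum_(j < m) `|B i j|) ^+ 2) => [|x].
  by apply: sumr_ge0 => i _; exact: sqr_ge0.
rewrite mulr_suml; apply: ler_sum => i _; rewrite -H_hilbert.
rewrite -[sum_ip ip x x]sqr_sqrtr ?dot_ge0// -exprMn.
rewrite ler_pXn2r ?nnegrE ?mulr_ge0 ?sqrtr_ge0 ?sumr_ge0//.
apply: le_trans (ler_norm_sum _ _ _) _; rewrite mulr_suml.
by apply: ler_sum => j _; rewrite normrZ ler_wpM2l// norm_coord_le.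
Qed.

Lemma posdef_wnorm2_ge0 (d : nat) (W : 'M[R]_d) (x : 'I_d -> H) :
  posdef W -> 0 <= wnorm2 ip W x.
Proof.
move=> /posdef_cholesky[C _ ->].
by rewrite /wnorm2 mxactM sum_ip_mxact trmxK dot_ge0.
Qed.

(** With [W = C^T C], the weighted square norm of [x] is the square norm of [C x],
    and [x] is recovered by the bounded operator [C^-1]. *)
Lemma posdef_coercive (d : nat) (W : 'M[R]_d) : posdef W ->
  exists2 c : R, 0 <= c & forall x : 'I_d -> H,
    sum_ip ip x x <= c * wnorm2 ip W x.
Proof.
move=> /posdef_cholesky[C Cunit ->].
have [c c0 cP] := mxact_bounded (invmx C); exists c => // x.
rewrite /wnorm2 mxactM sum_ip_mxact trmxK.
by have := cP (mxact C x); rewrite -mxactM mulVmx// mxact1.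
Qed.

End PositiveDefinite.

(** * Weak compactness along ultrafilters *)

Section Ultrafilters.
Variable R : realType.

(** The values lie in a compact interval, so that they cluster at some [l]; an
    ultrafilter converges to each of its cluster points. *)
Lemma ultra_bounded_cvg (T : Type) (G : set_system T) (GU : UltraFilter G)
    (u : T -> R) (c : R) :
  (forall t, `|u t| <= c) -> exists l : R, u @ G --> l.
Proof.
move=> uc.
have Guc : (u @ G) `[- c, c]%classic.
  by apply: (@filterE _ G) => t; rewrite /= in_itv/= -ler_norml; exact: uc.
have [l [_ lG]] := segment_compact _ Guc.
exists l => B Bl; have [//|GnB] := in_ultra_setVsetC (u @^-1` B) GU.
have [x [nBx Bx]] : (~` B) `&` B !=set0 by apply: lG.
by [].
Qed.

(** A filter is the intersection of the ultrafilters above it; this plays the role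
    of the usual argument by subsequences of subsequences. *)
Lemma cvg_ultra (T : Type) (F : set_system T) (FF : ProperFilter F)
    (u : T -> R) (l : R) :
  (forall G : set_system T, UltraFilter G -> F `<=` G -> u @ G --> l) ->
  u @ F --> l.
Proof.
move=> h B Bl; apply: contrapT => nFB.
have wF : ProperFilter (within (~` (u @^-1` B)) F).
  apply: Build_ProperFilter; rewrite /within/= => FB; apply: nFB.
  by apply: (@filterS _ F _ _ _ _ FB) => t /= ht; apply: contrapT => /ht.
have [G [GU wG]] := ultraFilterLemma wF.
have FG : F `<=` G by move=> X FX; apply: wG; apply: (@filterS _ F _ _ _ _ FX).
have GB : G (u @^-1` B) by exact: h Bl.
have GnB : G (~` (u @^-1` B)) by apply: wG; apply: (@filterE _ F).
by have [t []] := @filter_ex _ G _ _ (@filterI _ G _ _ _ GB GnB).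
Qed.

End Ultrafilters.

Section WeakCompactness.
Variables (R : realType) (H : completeNormedModType R) (ip : {dot H for idfun}).
Hypothesis H_hilbert : hilbert_inner ip.

Lemma norm_dot_le (u v : H) : `|ip u v| <= `|u| * `|v|.
Proof.
rewrite -(@ler_pXn2r _ 2)// ?nnegrE ?mulr_ge0//.
by rewrite exprMn !H_hilbert real_normK ?num_real// dot_cauchy_schwarz.
Qed.

Lemma dot_cvgl (T : Type) (F : set_system T) (FF : Filter F)
    (u : T -> H) (l w : H) :
  u @ F --> l -> ip (u t) w @[t --> F] --> ip l w.
Proof.
move=> ul; apply/cvgrPdist_le => e e0.
have w1 : 0 < `|w| + 1 by rewrite ltr_wpDl.
have /cvgrPdist_lt/(_ (e / (`|w| + 1)))/(_ (divr_gt0 e0 w1)) := ul.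
apply: filterS => t ht; rewrite -dotBl.
apply: le_trans (norm_dot_le _ _) _.
apply: (@le_trans _ _ (e / (`|w| + 1) * `|w|)); first by rewrite ler_wpM2r// ltW.
by rewrite -mulrA ler_piMr ?(ltW e0)// mulrC ler_pdivrMr// mul1r lerDl.
Qed.

(** A bounded linear form [l] is represented by the minimizer of
    [g v = <v, v> - 2 l v]. The parallelogram identity makes minimizing vectors
    Cauchy. A first variation at a vector that is optimal up to [e] bounds
    [<a, w> - l w] by [sqrt e] times the norm of [w], so that the representation
    holds in the limit. *)
Section Riesz.
Variables (l : H -> R) (C : R).
Hypothesis lD : forall u v, l (u + v) = l u + l v.
Hypothesis lZ : forall a v, l (a *: v) = a * l v.
Hypothesis l_bounded : forall w, `|l w| <= C * `|w|.

Let g (v : H) := ip v v - 2 * l v.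
Let m := inf (range g).

Let g_lbound : lbound (range g) (- C ^+ 2).
Proof.
move=> _ [v _ <-]; rewrite /g -H_hilbert.
have := l_bounded v; rewrite ler_norml => /andP[_ h].
have := sqr_ge0 (`|v| - C); nra.
Qed.

Let m_le v : m <= g v.
Proof. by apply: ge_inf; [exists (- C ^+ 2); exact: g_lbound | exists v]. Qed.

Let g_midpoint (a b : H) (e : R) : g a < m + e -> g b < m + e -> `|a - b| ^+ 2 <= 4 * e.
Proof.
move=> ga gb; rewrite H_hilbert dot_sqrB.
have := m_le (2^-1 *: (a + b)).
rewrite /g dotZl dotZr dot_sqrD lZ lD; move: ga gb; rewrite /g; lra.
Qed.

Let g_variation (a : H) (e : R) (w : H) :
  0 < e -> g a < m + e -> (ip a w - l w) ^+ 2 <= e * ip w w.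
Proof.
move=> e0 ga; have [->|w0] := eqVneq w 0.
  have l0 : l 0 = 0 by rewrite -(scale0r 0) lZ mul0r.
  by rewrite !dot0r l0 subr0 mulr0 expr0n.
have ww : 0 < ip w w by exact: neq0_dnorm_gt0.
(* the step that minimizes g on the line through a with direction w *)
pose t := - (ip a w - l w) / ip w w.
have := m_le (a + t *: w).
rewrite /g dot_sqrD !dotZl !dotZr lD lZ => h.
have tw : t * ip w w = - (ip a w - l w) by rewrite /t divfK// gt_eqF.
have : - e <= t * (ip a w - l w) by move: ga h; rewrite tw /g; lra.
move=> /(ler_wpM2r (ltW ww)).
by rewrite mulrAC tw; nra.
Qed.

Lemma riesz_representation : exists v, forall w, l w = ip v w.
Proof.
(* the filter of minimizing vectors *)
pose G := filter_from [set e : R | 0 < e] (fun e => [set v | g v < m + e]).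
have GF : ProperFilter G.
  apply: filter_from_proper; last first.
    move=> e /= e0; have [|_ [v _ <-] ge] := @inf_adherent R (range g) e e0.
      by split; [exists (g 0); exists 0 | exists (- C ^+ 2); exact: g_lbound].
    by exists v.
  apply: filter_from_filter; first by exists 1; exact: ltr01.
  move=> i j /= i0 j0; exists (Num.min i j); first by rewrite /= lt_min i0 j0.
  by move=> v /= /lt_le_trans h; split; apply: h; rewrite lerD2l ge_min lexx ?orbT.
have Gcauchy : cauchy G.
  apply: cauchy_exP => e e0; have e8 : 0 < e ^+ 2 / 8 by rewrite divr_gt0// exprn_gt0.
  have [a ga] : [set v | g v < m + e ^+ 2 / 8] !=set0.
    by apply: (@filter_ex _ G); exists (e ^+ 2 / 8).
  exists a, (e ^+ 2 / 8) => // b gb; rewrite -ball_normE/=.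
  rewrite -(@ltr_pXn2r _ 2)// ?nnegrE ?(ltW e0)//.
  apply: le_lt_trans (g_midpoint ga gb) _; nra.
have /cvg_ex[v Gv] := @cauchy_cvg H G GF Gcauchy.
exists v => w; apply: (cvg_unique (@norm_hausdorff R R) (F := ip a w @[a --> G])).
  apply/cvgrPdist_le => e e0.
  have w1 : 0 < ip w w + 1 by rewrite ltr_wpDl// dot_ge0.
  have e1 : 0 < e ^+ 2 / (ip w w + 1) by rewrite divr_gt0// exprn_gt0.
  exists (e ^+ 2 / (ip w w + 1)) => // a /= /(g_variation w e1) h.
  rewrite distrC -(@ler_pXn2r _ 2)// ?nnegrE ?(ltW e0)// real_normK ?num_real//.
  apply: le_trans h _; rewrite -mulrA ler_piMr ?sqr_ge0// mulrC.
  by rewrite ler_pdivrMr// mul1r lerDl.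
exact: dot_cvgl Gv.
Qed.

End Riesz.

(** Bounded sequences of a Hilbert space have weak limits along every ultrafilter:
    the limits of the inner products with [w] form a bounded linear form of [w]. *)
Lemma ultra_weak_cvg (G : set_system nat) (GU : UltraFilter G)
    (v : nat -> H) (c : R) : (forall k, `|v k| <= c) ->
  exists l : H, forall w, ip (v k) w @[k --> G] --> ip l w.
Proof.
move=> vc.
have vwc w k : `|ip (v k) w| <= c * `|w|.
  by apply: le_trans (norm_dot_le _ _) _; rewrite ler_wpM2r.
have /choice[l lP] : forall w, exists l : R, ip (v k) w @[k --> G] --> l.
  by move=> w; exact: ultra_bounded_cvg (vwc w).
have lim_uniq (f : nat -> R) (a b : R) : f @ G --> a -> f @ G --> b -> a = b.
  exact: (cvg_unique (@norm_hausdorff R R)).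
have [x y|a y|w|x xP] := @riesz_representation l c.
- apply: (lim_uniq (fun k => ip (v k) (x + y))); first exact: lP.
  by under eq_fun do rewrite dotDr; exact: cvgD.
- apply: (lim_uniq (fun k => ip (v k) (a *: y))); first exact: lP.
  by under eq_fun do rewrite dotZr; exact: cvgMr.
- apply: (@ler_cvg_to nat G _ R (fun k => `|ip (v k) w|) (cst (c * `|w|))).
  + exact: cvg_norm.
  + exact: cvg_cst.
  + by apply: filterE => k; exact: vwc.
- by exists x => w; rewrite -xP.
Qed.

End WeakCompactness.

(** * The primal-dual operator *)

Lemma subrACA (V : zmodType) (a b c e : V) : a - b - (c - e) = a - c - (b - e).
Proof. by rewrite !opprD addrACA. Qed.

Section MonotoneOperators.
Variables (R : realType) (H : completeNormedModType R) (ip : {dot H for idfun}).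

Lemma op_inv_monotone (A : H -> set H) :
  monotone_op ip A -> monotone_op ip (op_inv A).
Proof. by move=> Amon x y u v Aux Avy; rewrite dotC; exact: Amon. Qed.

(** Otherwise adding the pair [(x, u)] to the graph would be a proper monotone
    extension. *)
Lemma maximal_related (A : H -> set H) (x u : H) :
  maximally_monotone ip A ->
  (forall y v, A y v -> 0 <= ip (u - v) (x - y)) -> A x u.
Proof.
move=> [Amon Amax] xu.
pose B y := A y `|` [set v | y = x /\ v = u].
suff <- : B = A by right.
apply: Amax => [y y' v v' [Ayv|[-> ->]] [Ayv'|[-> ->]]|y v Ayv]; last by left.
- exact: Amon.
- by rewrite -opprB dotNl -(opprB x) dotNr opprK; exact: xu.
- exact: xu.
- by rewrite !subrr dot0l.
Qed.

Lemma primal_dual_part_related (n : nat) (A : 'I_n -> H -> set H) (p i : 'I_n) x u :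
  maximally_monotone ip (A i) ->
  (forall y v, primal_dual_part A p i y v -> 0 <= ip (u - v) (x - y)) ->
  primal_dual_part A p i x u.
Proof.
rewrite /primal_dual_part; case: ifP => _ Amax xu; first exact: maximal_related xu.
by apply: (maximal_related Amax) => y v Ayv; rewrite dotC; exact: xu.
Qed.

Section PrimalDual.
Variables (n : nat) (p : 'I_n).

Lemma Gamma_mxE (i j : 'I_n) :
  Gamma_mx R p i j = (i == p)%:R - (j == p)%:R.
Proof. by rewrite !mxE; do 2!case: (_ == p). Qed.

Lemma tr_Gamma_mx : (Gamma_mx R p)^T = - Gamma_mx R p.
Proof. by rewrite /Gamma_mx linearB/= trmxK opprB. Qed.

(** A skew matrix contributes nothing to monotonicity estimates. *)
Lemma sum_ip_Gamma (y : 'I_n -> H) : sum_ip ip (mxact (Gamma_mx R p) y) y = 0.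
Proof.
have : sum_ip ip (mxact (Gamma_mx R p) y) y
     = - sum_ip ip (mxact (Gamma_mx R p) y) y.
  rewrite {1}sum_ip_mxact tr_Gamma_mx -scaleN1r mxactZl scaleN1r.
  by rewrite [LHS]dotNr dotC.
lra.
Qed.

Lemma Phi_opP (A : 'I_n -> H -> set H) (y u : 'I_n -> H) :
  Phi_op A p y u <->
  forall i, primal_dual_part A p i (y i) (u i - mxact (Gamma_mx R p) y i).
Proof.
split=> [[v vP [_ -> <-]] i|h].
  by rewrite [X in X - _](_ : _ = v i + mxact (Gamma_mx R p) y i)// addrK; exact: vP.
exists (u - mxact (Gamma_mx R p) y); first exact: h.
by exists (mxact (Gamma_mx R p) y) => //; rewrite subrK.
Qed.

Lemma pd_resolventP (A : 'I_n -> H -> set H) (M : 'M[R]_n) (w y : 'I_n -> H) :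
  pd_resolvent A p M w y <-> Phi_op A p y (w - mxact M y).
Proof.
split=> [[_ -> [v vP <-]]|h]; first by rewrite addrC addKr.
by exists (mxact M y) => //; exists (w - mxact M y) => //; rewrite addrC subrK.
Qed.

(** From [u_i] in [A_i x] with zero sum, take [x] as coordinate [p] and the [u_i]
    as the other coordinates. *)
Lemma zer_Phi_op (A : 'I_n -> H -> set H) :
  zer (op_sum A) !=set0 -> zer (Phi_op A p) !=set0.
Proof.
move=> [x [u uP u0]].
pose ybar i := if i == p then x else u i.
exists ybar; apply/Phi_opP => i; rewrite sub0r mxactE.
under eq_bigr do rewrite Gamma_mxE.
rewrite /primal_dual_part /ybar; case: eqVneq => [->|ip'].
  suff -> : - (\sum_(j < n) ((1 - (j == p)%:R) *: (if j == p then x else u j)))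
            = u p by [].
  rewrite (bigD1 p)//= eqxx subrr scale0r add0r.
  under eq_bigr => j jp do rewrite (negPf jp) subr0 scale1r.
  by move: u0; rewrite (bigD1 p)//= => /eqP; rewrite addr_eq0 => /eqP ->.
rewrite /op_inv/=.
suff -> : - (\sum_(j < n) ((0 - (j == p)%:R) *: (if j == p then x else u j))) = x
  by [].
rewrite (bigD1 p)//= eqxx sub0r scaleN1r big1 ?addr0 ?opprK// => j jp.
by rewrite (negPf jp) subr0 scale0r.
Qed.

(** Maximality of the primal-dual operator. The skew part drops out, which leaves
    a product of maximally monotone operators. At a coordinate where the pair is
    not in the graph, some point of that graph has a negative product with it; at
    the others the pair itself gives the product zero. The tuple of these points is
    in the graph of the product, and by hypothesis the sum of the products is
    nonnegative: no coordinate can be of the first kind. *)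
Lemma Phi_op_related (A : 'I_n -> H -> set H) (y u : 'I_n -> H) :
  (forall i, maximally_monotone ip (A i)) ->
  (forall y' u', Phi_op A p y' u' -> 0 <= sum_ip ip (u - u') (y - y')) ->
  Phi_op A p y u.
Proof.
move=> Amax yu; apply/Phi_opP.
set w := u - mxact (Gamma_mx R p) y.
suff : forall i, primal_dual_part A p i (y i) (w i) by [].
have /choice[ab abP] : forall i, exists ab : H * H,
    [/\ primal_dual_part A p i ab.1 ab.2, ip (w i - ab.2) (y i - ab.1) <= 0
      & ip (w i - ab.2) (y i - ab.1) = 0 -> primal_dual_part A p i (y i) (w i)].
  move=> i; have [yw|nyw] := pselect (primal_dual_part A p i (y i) (w i)).
    by exists (y i, w i); rewrite /= subrr dot0l.
  have [//|/existsNP[a /existsNP[b /not_implyP[ab /negP]]]] :=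
    pselect (forall a b, primal_dual_part A p i a b -> 0 <= ip (w i - b) (y i - a)).
    by move=> /(primal_dual_part_related (Amax i)).
  rewrite -ltNge => lt0; exists (a, b); split => //=; first exact: ltW.
  by move=> eq0; rewrite eq0 ltxx in lt0.
pose a i := (ab i).1; pose b i := (ab i).2.
have := yu a (b + mxact (Gamma_mx R p) a).
have -> : u - (b + mxact (Gamma_mx R p) a) = (w - b) + mxact (Gamma_mx R p) (y - a).
  by rewrite /w raddfB/= opprD addrA [RHS]addrA; congr (_ - _);
     rewrite addrAC subrK.
rewrite dotDl/= sum_ip_Gamma addr0 => ge0 i.
have [_ _] := abP i; apply.
have /ge0 {}ge0 : Phi_op A p a (b + mxact (Gamma_mx R p) a).
  exists b; first by move=> j; have [] := abP j.
  by exists (mxact (Gamma_mx R p) a).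
have le0 j : 0 <= - ip (w j - b j) (y j - a j) by rewrite oppr_ge0; have [] := abP j.
have /psumr_eq0P : \sum_(j < n) - ip (w j - b j) (y j - a j) = 0.
  apply/eqP; rewrite eq_le sumr_ge0 ?andbT// sumrN oppr_le0; exact: ge0.
by move=> /(_ (fun j _ => le0 j) i isT) /eqP; rewrite oppr_eq0 => /eqP.
Qed.

End PrimalDual.

Section Cocoercive.
Variables (n : nat) (F : {set 'I_n}) (A : op_tuple ip F) (beta : 'I_n -> R).
Hypothesis A_coco : forall i, i \in F -> cocoercive ip (beta i) (A i).
Variable p : 'I_n.
Hypothesis p_notin_F : p \notin F.

Lemma primal_dual_part_cocoercive i x x' u u' :
  primal_dual_part A p i x u -> primal_dual_part A p i x' u' ->
  (if i \in F then beta i * `|x - x'| ^+ 2 else 0) <= ip (u - u') (x - x').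
Proof.
rewrite /primal_dual_part; have [iF|_] := boolP (i \in F).
  have /negPf -> : i != p by apply: contraNneq p_notin_F => <-.
  by rewrite dotC; apply: (A_coco iF).2.
have [Amon _] := ops_maximal A i.
by case: eqP => _; [exact: Amon | exact: op_inv_monotone].
Qed.

(** Cocoercivity of [A_i] is strong monotonicity of its inverse, which is the
    operator that acts on coordinate [i] since [i] differs from [p]. *)
Lemma Phi_op_cocoercive (y y' u u' : 'I_n -> H) :
  Phi_op A p y u -> Phi_op A p y' u' ->
  \sum_(i < n) (if i \in F then beta i * `|y i - y' i| ^+ 2 else 0)
    <= sum_ip ip (u - u') (y - y').
Proof.
move=> /Phi_opP yu /Phi_opP yu'.
have -> : sum_ip ip (u - u') (y - y')
    = sum_ip ip (u - u' - mxact (Gamma_mx R p) (y - y')) (y - y').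
  by rewrite [RHS]dotBl/= sum_ip_Gamma subr0.
apply: ler_sum => i _.
rewrite [X in ip X _](_ : _ = (u i - mxact (Gamma_mx R p) y i)
    - (u' i - mxact (Gamma_mx R p) y' i)); first exact: primal_dual_part_cocoercive.
rewrite raddfB/=.
transitivity (u i - u' i - (mxact (Gamma_mx R p) y i - mxact (Gamma_mx R p) y' i)) => //.
by rewrite subrACA.
Qed.

Hypothesis beta_gt0 : forall i, i \in F -> 0 < beta i.
Variable M : 'M[R]_n.
Hypothesis M_kernel : p_kernel F p M.

Hypothesis H_hilbert : hilbert_inner ip.

(** One row of the inclusion. As [M + Gamma] is lower triangular with the diagonal
    of [M], this row only involves the coordinates up to [i]; coordinate [i] itself is
    controlled by strong monotonicity, which comes from the diagonal entry outside
    [F] and from cocoercivity in [F], where that entry vanishes. *)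
Lemma pd_resolvent_lipschitz_row (i : 'I_n) (y y' w w' : 'I_n -> H) :
  Phi_op A p y (w - mxact M y) -> Phi_op A p y' (w' - mxact M y') ->
  (if i \in F then beta i else M i i) * `|y i - y' i|
   <= `|w i - w' i| + \sum_(j < n | (j < i)%N)
                        `|(M + Gamma_mx R p) i j| * `|y j - y' j|.
Proof.
have [_ /is_trig_mxP Ltrig Mge0 M0] := M_kernel.
set L := M + Gamma_mx R p in Ltrig *.
move=> /Phi_opP/(_ i) yw /Phi_opP/(_ i) yw'.
have := primal_dual_part_cocoercive yw yw'.
pose r := w i - w' i - \sum_(j < n | (j < i)%N) L i j *: (y j - y' j).
have -> : (w - mxact M y) i - mxact (Gamma_mx R p) y i
    - ((w' - mxact M y') i - mxact (Gamma_mx R p) y' i) = r - M i i *: (y i - y' i).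
  transitivity (w i - w' i - mxact L (y - y') i).
    rewrite /L mxactDl !(raddfB (mxact _))/=.
    transitivity (w i - mxact M y i - mxact (Gamma_mx R p) y i
      - (w' i - mxact M y' i - mxact (Gamma_mx R p) y' i)) => //.
    transitivity (w i - w' i - (mxact M y i - mxact M y' i
      + (mxact (Gamma_mx R p) y i - mxact (Gamma_mx R p) y' i))) => //.
    by rewrite subrACA (subrACA (w i)) [in RHS]opprD [RHS]addrA.
  rewrite /r -[RHS]addrA -opprD; congr (_ - _).
  rewrite mxactE (bigID (fun j : 'I_n => (j < i)%N))/=; congr (_ + _).
  rewrite (bigD1 i)/= ?ltnn// big1 ?addr0 => [|j /andP[]].
    by rewrite mxE Gamma_mxE subrr addr0.
  rewrite -leqNgt => ij ji; rewrite Ltrig ?scale0r//.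
  by rewrite ltn_neqAle eq_sym ji.
rewrite dotBl dotZl -H_hilbert.
set D := `|y i - y' i|.
have rD : ip r (y i - y' i) <= `|r| * D.
  by apply: le_trans (ler_norm _) (norm_dot_le H_hilbert _ _).
have rle : `|r| <= `|w i - w' i|
    + \sum_(j < n | (j < i)%N) `|L i j| * `|y j - y' j|.
  apply: le_trans (ler_normB _ _) _; rewrite lerD2l.
  apply: le_trans (ler_norm_sum _ _ _) _.
  by apply: ler_sum => j _; rewrite normrZ.
move=> h; apply: le_trans rle.
have [D0|D0] := eqVneq D 0; first by rewrite D0 mulr0.
have Dgt0 : 0 < D by rewrite lt_neqAle eq_sym D0 normr_ge0.
rewrite -(ler_pM2r Dgt0); apply: le_trans rD.
have := Mge0 i; have := sqr_ge0 D.
by move: h; case: ifP => _; nra.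
Qed.

(** The resolvent of a [p]-kernel is Lipschitz; this is what bounds the sequence
    [y] once [z] is known to be bounded. *)
Lemma pd_resolvent_bounded :
  exists2 c : R, 0 <= c & forall (y y' w w' : 'I_n -> H) (N : R),
    Phi_op A p y (w - mxact M y) -> Phi_op A p y' (w' - mxact M y') ->
    (forall i, `|w i - w' i| <= N) -> forall i, `|y i - y' i| <= c * N.
Proof.
have [_ _ Mge0 M0] := M_kernel.
suff rows m : exists2 c : R, 0 <= c &
    forall (y y' w w' : 'I_n -> H) (N : R),
    Phi_op A p y (w - mxact M y) -> Phi_op A p y' (w' - mxact M y') ->
    (forall i, `|w i - w' i| <= N) ->
    forall i : 'I_n, (i < m)%N -> `|y i - y' i| <= c * N.
  have [c c0 cP] := rows n.
  by exists c => // y y' w w' N yw yw' wN i; exact: cP yw yw' wN i (ltn_ord i).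
(* forward substitution: a constant for the first m rows yields one for the next *)
elim: m => [|m [c c0 IH]]; first by exists 0.
have [mn|nm] := ltnP m n; last first.
  exists c => // y y' w w' N yw yw' wN i _.
  by apply: (IH y y' w w') => //; exact: leq_trans (ltn_ord i) nm.
pose i := Ordinal mn.
pose k := if i \in F then beta i else M i i.
have k0 : 0 < k.
  rewrite /k; case: ifP => iF; first exact: beta_gt0.
  rewrite lt_neqAle Mge0 andbT eq_sym; apply/eqP => /M0; by rewrite iF.
pose s := \sum_(j < n | (j < i)%N) `|(M + Gamma_mx R p) i j|.
have s0 : 0 <= s by exact: sumr_ge0.
have c'0 : 0 <= k^-1 * (1 + s * c).
  by rewrite mulr_ge0 ?invr_ge0 ?(ltW k0)// addr_ge0// mulr_ge0.
exists (c + k^-1 * (1 + s * c)) => [|y y' w w' N yw yw' wN j]; first exact: addr_ge0.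
have N0 : 0 <= N by apply: le_trans (wN i).
rewrite ltnS leq_eqVlt => /orP[/eqP jm|jm]; last first.
  by apply: le_trans (IH _ _ _ _ _ yw yw' wN j jm) _; rewrite ler_wpM2r// lerDl.
have -> : j = i by exact/val_inj.
apply: (@le_trans _ _ (k^-1 * (1 + s * c) * N)); last by rewrite ler_wpM2r// lerDr.
rewrite -mulrA ler_pdivlMl//.
apply: le_trans (pd_resolvent_lipschitz_row i yw yw') _.
rewrite mulrDl mul1r lerD// -mulrA mulr_suml; apply: ler_sum => l li.
by rewrite ler_wpM2l//; exact: IH yw yw' wN l li.
Qed.

End Cocoercive.

End MonotoneOperators.

(** * Limits of sequences of tuples *)

Section Limits.
Variable R : realType.

Lemma descent_cvg (a w : nat -> R) :
  (forall k, a k.+1 <= a k - w k) -> (forall k, 0 <= a k) ->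
  (forall k, 0 <= w k) -> cvgn a /\ w @ \oo --> 0.
Proof.
move=> step a0 w0.
have a_cvg : cvgn a.
  apply: nonincreasing_is_cvgn; last by exists 0 => _ [k _ <-].
  by apply/nonincreasing_seqP => k; have := step k; have := w0 k; lra.
split=> //.
apply: (@squeeze_cvgr _ _ _ _ (cst 0) (fun k => a k - a k.+1)).
- by apply: nearW => k; rewrite w0/=; have := step k; lra.
- exact: cvg_cst.
- rewrite -(subrr (limn a)); apply: cvgB => //.
  by rewrite -(cvg_shiftS a) in a_cvg *.
Qed.

Variables (H : completeNormedModType R) (ip : {dot H for idfun}).

Lemma sum_ip_cvg (m : nat) (F : set_system nat) (FF : Filter F)
    (x : nat -> 'I_m -> H) (l w : 'I_m -> H) :
  (forall i, ip (x k i) (w i) @[k --> F] --> ip (l i) (w i)) ->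
  sum_ip ip (x k) w @[k --> F] --> sum_ip ip l w.
Proof. move=> h; apply: cvg_big => //; apply: add_continuous. Qed.

(** The product of a strongly null sequence with a bounded one. *)
Lemma sum_ip_cvg0 (m : nat) (F : set_system nat) (FF : ProperFilter F)
    (x y : nat -> 'I_m -> H) (c : R) :
  sum_ip ip (x k) (x k) @[k --> F] --> 0 ->
  (forall k, sum_ip ip (y k) (y k) <= c) ->
  sum_ip ip (x k) (y k) @[k --> F] --> 0.
Proof.
move=> x0 yc.
have sx0 : Num.sqrt (sum_ip ip (x k) (x k) * c) @[k --> F] --> 0.
  rewrite -(sqrtr0 R) -(mul0r c); apply: cvg_comp; last exact: sqrt_continuous.
  exact: cvgMl.
apply/cvgr0Pnorm_le => e e0.
move/cvgr0Pnorm_le : sx0 => /(_ e e0); apply: filterS => k; apply: le_trans.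
rewrite (ger0_norm (sqrtr_ge0 _)) -sqrtr_sqr; apply: ler_wsqrtr.
apply: le_trans (dot_cauchy_schwarz (@sum_ip R H ip m) _ _) _.
by apply: ler_wpM2l; [exact: dot_ge0 | exact: yc].
Qed.

Lemma strong_cvg0 (m : nat) (x : nat -> 'I_m -> H) :
  sum_ip ip (x k) (x k) @[k --> \oo] --> 0 -> strong_cvg ip x 0.
Proof.
move=> x0; rewrite /strong_cvg /sum_norm -(sqrtr0 R).
under eq_fun do rewrite subr0.
by apply: cvg_comp x0 _; exact: sqrt_continuous.
Qed.

Hypothesis H_hilbert : hilbert_inner ip.

Lemma sum_ip_mxact_cvg0 (m k : nat) (B : 'M[R]_(k, m)) (F : set_system nat)
    (FF : ProperFilter F) (x : nat -> 'I_m -> H) :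
  sum_ip ip (x j) (x j) @[j --> F] --> 0 ->
  sum_ip ip (mxact B (x j)) (mxact B (x j)) @[j --> F] --> 0.
Proof.
move=> x0; have [c c0 cP] := mxact_bounded H_hilbert B.
apply: (@squeeze_cvgr _ _ _ _ (cst 0) (fun j => c * sum_ip ip (x j) (x j))).
- by apply: nearW => j; rewrite dot_ge0 cP.
- exact: cvg_cst.
- by rewrite -(mulr0 c); exact: cvgMr.
Qed.

Lemma ultra_weak_cvg_tuple (m : nat) (G : set_system nat) (GU : UltraFilter G)
    (x : nat -> 'I_m -> H) (c : R) : (forall k i, `|x k i| <= c) ->
  exists l : 'I_m -> H, forall w, sum_ip ip (x k) w @[k --> G] --> sum_ip ip l w.
Proof.
move=> xc.
have /choice[l lP] (i : 'I_m) : exists l, forall w, ip (x k i) w @[k --> G] --> ip l w.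
  exact: (@ultra_weak_cvg _ _ _ H_hilbert G GU (x ^~ i) c).
by exists l => w; apply: sum_ip_cvg => i; exact: lP.
Qed.

End Limits.

(** * Descent and weak limits of the iteration *)

Section PrimalDualIteration.
Variables (R : realType) (H : completeNormedModType R) (ip : {dot H for idfun}).
Hypothesis H_hilbert : hilbert_inner ip.
Variables (n : nat) (F : {set 'I_n}) (A : op_tuple ip F) (beta : 'I_n -> R).
Hypothesis beta_gt0 : forall i, i \in F -> 0 < beta i.
Hypothesis A_coco : forall i, i \in F -> cocoercive ip (beta i) (A i).
Variable p : 'I_n.
Hypothesis p_notin_F : p \notin F.

Lemma indic_mx_kernel (m : nat) (E : 'M[R]_(n, m)) (x : 'I_m -> H) (i : 'I_n) :
  (1%:M - indic_mx R F) *m E = 0 -> i \notin F -> mxact E x i = 0.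
Proof.
move=> E0 iF; rewrite mxactE big1// => j _.
have := congr1 (fun X : 'M[R]_(n, m) => X i j) E0.
rewrite mulmxBl mul1mx /indic_mx mul_diag_mx !mxE (negPf iF) mul0r subr0 => ->.
by rewrite scale0r.
Qed.

(** Expand the square norm of [e + 2 b d]. *)
Lemma weighted_young (b : R) (e d : H) : 0 < b ->
  - (2 * (b * `|d| ^+ 2)) - 2 * ip e d <= 2^-1 * (b^-1 * `|e| ^+ 2).
Proof.
move=> b0; have := dot_ge0 ip (e + (2 * b) *: d).
rewrite dot_sqrD !(dotZl, dotZr) -!H_hilbert => h.
rewrite -(ler_pM2l b0).
have -> : b * (2^-1 * (b^-1 * `|e| ^+ 2)) = 2^-1 * `|e| ^+ 2.
  by field; rewrite gt_eqF.
nra.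
Qed.

(** The error term [E x] is supported in [F], exactly where the primal-dual operator
    is strongly monotone, so that Young's inequality absorbs it; the weights of the
    latter produce the matrix [Bdagger]. *)
Lemma Phi_op_residual_le (m : nat) (E : 'M[R]_(n, m)) (x : 'I_m -> H)
    (y ybar u : 'I_n -> H) :
  (1%:M - indic_mx R F) *m E = 0 -> Phi_op A p y u -> zer (Phi_op A p) ybar ->
  - (2 * sum_ip ip (mxact E x + u) (y - ybar))
    <= 2^-1 * sum_ip ip (mxact (Bdagger F beta) (mxact E x)) (mxact E x).
Proof.
move=> E0 yu /(Phi_op_cocoercive A_coco p_notin_F yu); rewrite subr0 => h.
rewrite dotDl/=.
have e0 i : i \notin F -> mxact E x i = 0 by exact: indic_mx_kernel.
set e := mxact E x in e0 *.
apply: (@le_trans _ _ (- (2 * (sum_ip ip e (y - ybar) +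
  \sum_(i < n) (if i \in F then beta i * `|y i - ybar i| ^+ 2 else 0))))).
  by move: h; lra.
rewrite /sum_ip -big_split/= !mulr_sumr -sumrN; apply: ler_sum => i _.
have -> : mxact (Bdagger F beta) e i = (if i \in F then (beta i)^-1 else 0) *: e i.
  rewrite mxactE (bigD1 i)//= !mxE eqxx mulr1n big1 ?addr0// => j ji.
  by rewrite !mxE eq_sym (negPf ji) mulr0n scale0r.
have [iF|/e0 ->] := boolP (i \in F); last first.
  by rewrite !dot0l scaler0 dot0l !(addr0, mulr0, oppr0).
rewrite dotZl -H_hilbert.
apply: le_trans (weighted_young (e i) (y i - ybar i) (beta_gt0 iF)).
by rewrite mulrDr opprD addrC lexx.
Qed.

Variable d : nat.
Variables (U : 'M[R]_d) (S : 'M[R]_(n, d)) (P : 'M[R]_(d, n)) (Q : 'M[R]_d).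
Hypothesis Q_sym : Q^T = Q.
Let E := P^T *m Q *m U - S *m U.
Let W := Q *m U + (Q *m U)^T - U^T *m Q *m U
         - 2^-1 *: (E^T *m Bdagger F beta *m E).
Hypothesis PQS : (1%:M - indic_mx R F) *m (P^T *m Q - S) *m U = 0.

(** Expand the weighted square norm around [P ybar], using
    [z - P ybar = x + P (y - ybar)] with [x = z - P y]. The terms in [x] alone make
    up [W] except for its last summand; the cross term is the product of
    [P^T Q U x = E x + S U x] with [y - ybar], and [S U x] is a value of the
    primal-dual operator at [y]. *)
Lemma fejer_step (z : 'I_d -> H) (y ybar : 'I_n -> H) :
  Phi_op A p y (mxact (S *m U) (z - mxact P y)) -> zer (Phi_op A p) ybar ->
  wnorm2 ip Q (z - mxact U (z - mxact P y) - mxact P ybar)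
    <= wnorm2 ip Q (z - mxact P ybar) - wnorm2 ip W (z - mxact P y).
Proof.
set x := z - mxact P y => yx ybar0.
have E0 : (1%:M - indic_mx R F) *m E = 0 by rewrite /E -mulmxBl mulmxA.
have := Phi_op_residual_le x E0 yx ybar0.
have -> : mxact E x + mxact (S *m U) x = mxact (P^T *m Q *m U) x.
  by rewrite -mxactDl /E subrK.
set D := y - ybar.
have zE : z - mxact P ybar = x + mxact P D.
  by rewrite /x /D (raddfB (mxact P))/= addrA subrK.
have -> : z - mxact U x - mxact P ybar = z - mxact P ybar - mxact U x by rewrite addrAC.
rewrite zE /wnorm2; clearbody x D.
have QC (a b : 'I_d -> H) : sum_ip ip (mxact Q a) b = sum_ip ip (mxact Q b) a.
  by rewrite sum_ip_mxact Q_sym dotC.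
have -> : sum_ip ip (mxact W x) x = 2 * sum_ip ip (mxact Q (mxact U x)) x
    - sum_ip ip (mxact Q (mxact U x)) (mxact U x)
    - 2^-1 * sum_ip ip (mxact (Bdagger F beta) (mxact E x)) (mxact E x).
  rewrite /W; move: (E) => e.
  rewrite !mxactBl mxactDl mxactZl !mxactM !dotBl dotDl dotZl/=.
  rewrite !(sum_ip_mxact _ (_^T)) !trmxK mxactM.
  by rewrite (dotC _ x)/=; ring.
rewrite (raddfB (mxact Q))/= dotBl !dotBr/= (QC _ (mxact U x)).
have -> : sum_ip ip (mxact Q (mxact U x)) (x + mxact P D)
    = sum_ip ip (mxact Q (mxact U x)) x + sum_ip ip (mxact (P^T *m Q *m U) x) D.
  by rewrite dotDr/= !mxactM sum_ip_mxactr.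
lra.
Qed.

(** The graph of a maximally monotone operator is closed under weak convergence of
    the points and strong convergence of the values: the monotonicity inequality
    passes to the limit. *)
Lemma weak_limit_zer (G : set_system nat) (GF : ProperFilter G)
    (y u : nat -> 'I_n -> H) (ystar : 'I_n -> H) (c : R) :
  (forall k, Phi_op A p (y k) (u k)) ->
  (forall k, sum_ip ip (y k) (y k) <= c) ->
  sum_ip ip (u k) (u k) @[k --> G] --> 0 ->
  (forall w, sum_ip ip (y k) w @[k --> G] --> sum_ip ip ystar w) ->
  zer (Phi_op A p) ystar.
Proof.
move=> yu yc u0 yw; apply: (Phi_op_related (ops_maximal A)) => y' u' yu'.
have uy : sum_ip ip (u k) (y k - y') @[k --> G] --> 0.
  apply: (@sum_ip_cvg0 _ _ ip _ _ _ _ _ (2 * c + 2 * sum_ip ip y' y')) => // k.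
  have := dot_ge0 (@sum_ip R H ip n) (y k + y').
  by rewrite dot_sqrB dot_sqrD/=; have := yc k; lra.
have uyy : sum_ip ip (u k) (y k - y') - (sum_ip ip (y k) u' - sum_ip ip y' u') @[k --> G]
    --> 0 - (sum_ip ip ystar u' - sum_ip ip y' u').
  by apply: cvgB => //; apply: cvgB => //; exact: cvg_cst.
rewrite (_ : sum_ip _ _ _ = 0 - (sum_ip ip ystar u' - sum_ip ip y' u')); last first.
  by rewrite !sub0r dotNl dotBr/= !(dotC _ u')/=.
apply: (@ler_cvg_to nat G _ R (cst 0) _ _ _ _ uyy); first exact: cvg_cst.
apply: (@filterE _ G) => k.
have := Phi_op_cocoercive A_coco p_notin_F (yu k) yu'.
rewrite dotBl dotBr/= -!dotBr/= (dotC _ u') dotBl/=; apply: le_trans.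
apply: sumr_ge0 => i _; case: ifP => // iF.
by rewrite mulr_ge0 ?sqr_ge0// ltW// beta_gt0.
Qed.

End PrimalDualIteration.

Section Opial.
Variables (R : realType) (H : completeNormedModType R) (ip : {dot H for idfun}).
Hypothesis H_hilbert : hilbert_inner ip.
Variables (d : nat) (Q : 'M[R]_d).
Hypothesis Q_sym : Q^T = Q.

Lemma wnorm2_sub_sub (z a b : 'I_d -> H) :
  wnorm2 ip Q (z - a) - wnorm2 ip Q (z - b)
    = wnorm2 ip Q a - wnorm2 ip Q b - 2 * sum_ip ip z (mxact Q (a - b)).
Proof.
have QC (u v : 'I_d -> H) : sum_ip ip (mxact Q u) v = sum_ip ip (mxact Q v) u.
  by rewrite sum_ip_mxact Q_sym dotC.
rewrite /wnorm2 (dotC _ z)/= !(raddfB (mxact Q))/= !dotBl !dotBr/=.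
by rewrite (QC z a) (QC z b); ring.
Qed.

(** Opial's argument: the difference of the two convergent distances is affine in
    the product of [z k] with [Q (a - b)]. Hence this product converges, and its
    limits along the two filters, [<a, Q (a - b)>] and [<b, Q (a - b)>], agree. *)
Lemma opial_unique (z : nat -> 'I_d -> H) (a b : 'I_d -> H)
    (Ga Gb : set_system nat) (GaF : ProperFilter Ga) (GbF : ProperFilter Gb) :
  posdef Q -> \oo `<=` Ga -> \oo `<=` Gb ->
  cvgn (fun k => wnorm2 ip Q (z k - a)) -> cvgn (fun k => wnorm2 ip Q (z k - b)) ->
  (forall w, sum_ip ip (z k) w @[k --> Ga] --> sum_ip ip a w) ->
  (forall w, sum_ip ip (z k) w @[k --> Gb] --> sum_ip ip b w) ->
  a = b.
Proof.
move=> Qpos ooGa ooGb acvg bcvg za zb.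
pose v := mxact Q (a - b).
have [L sL] : exists L : R, sum_ip ip (z k) v @[k --> \oo] --> L.
  exists (2^-1 * (wnorm2 ip Q a - wnorm2 ip Q b
    - (limn (fun k => wnorm2 ip Q (z k - a))
       - limn (fun k => wnorm2 ip Q (z k - b))))).
  rewrite (_ : (fun k => _) = fun k => 2^-1 * (wnorm2 ip Q a - wnorm2 ip Q b
    - (wnorm2 ip Q (z k - a) - wnorm2 ip Q (z k - b)))).
    by apply: cvgMr; apply: cvgB; [exact: cvg_cst | exact: cvgB].
  by apply/funext => k; rewrite wnorm2_sub_sub -/v; field.
have aL : sum_ip ip a v = L.
  apply: (cvg_unique (@norm_hausdorff R R) (za v)).
  by apply: cvg_trans sL; exact: cvg_app.
have bL : sum_ip ip b v = L.
  apply: (cvg_unique (@norm_hausdorff R R) (zb v)).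
  by apply: cvg_trans sL; exact: cvg_app.
have [c c0 cP] := posdef_coercive H_hilbert Qpos.
have ab0 : sum_ip ip (a - b) (a - b) = 0.
  apply/eqP; rewrite eq_le dot_ge0 andbT.
  apply: le_trans (cP _) _.
  by rewrite /wnorm2 (dotC _ _ (a - b))/= dotBl/= -/v aL bL subrr mulr0.
by apply/eqP; rewrite -subr_eq0; apply/eqP; exact: (dot_eq0 ab0).
Qed.

End Opial.

(** * Convergence of the splitting method *)

Theorem theorem7p3 (R : realType) (H : completeNormedModType R)
    (ip : {dot H for idfun}) (H_hilbert : hilbert_inner ip) (H_dim : dim_ge2 H)
    (n d : nat) (n_gt0 : (0 < n)%N) (d_gt0 : (0 < d)%N)
    (F : {set 'I_n}) (F_strict : F \proper [set: 'I_n]%SET)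
    (A : op_tuple ip F) (A_zer : zer (op_sum A) !=set0)
    (beta : 'I_n -> R)
    (beta_gt0 : forall i, i \in F -> 0 < beta i)
    (A_coco : forall i, i \in F -> cocoercive ip (beta i) (A i))
    (T : op_tuple ip F -> ('I_d -> H) -> ('I_d -> H))
    (T_frugal : frugal_splitting T)
    (p : 'I_n) (p_notin_F : p \notin F)
    (U : 'M[R]_d) (S : 'M[R]_(n, d)) (P : 'M[R]_(d, n))
    (T_repr : has_representation T p (S *m U *m P) (S *m U) U (U *m P))
    (SUP_kernel : p_kernel F p (S *m U *m P))
    (ran_P : ran_mx P `<=` orth_compl (ker_mx U))
    (ker_S : orth_compl (ran_mx U) `<=` ker_mx S)
    (z : nat -> 'I_d -> H) (y : nat -> 'I_n -> H)
    (y_def : forall k,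
      pd_resolvent A p (S *m U *m P) (mxact (S *m U) (z k)) = [set y k])
    (z_def : forall k, z k.+1 = z k - mxact U (z k - mxact P (y k)))
    (Q : 'M[R]_d) (Q_sym : Q^T = Q) :
  let E := P^T *m Q *m U - S *m U in
  let W := Q *m U + (Q *m U)^T - U^T *m Q *m U
           - 2^-1 *: (E^T *m Bdagger F beta *m E) in
  (1%:M - indic_mx R F) *m (P^T *m Q - S) *m U = 0 ->
  (forall k (ybar : 'I_n -> H), zer (Phi_op A p) ybar ->
     wnorm2 ip Q (z k.+1 - mxact P ybar)
       <= wnorm2 ip Q (z k - mxact P ybar) - wnorm2 ip W (z k - mxact P (y k)))
  /\
  (posdef Q -> posdef W ->
   exists ystar : 'I_n -> H,
     [/\ zer (Phi_op A p) ystar,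
         strong_cvg ip (fun k => z k - mxact P (y k)) 0,
         (forall k, Phi_op A p (y k) (mxact (S *m U) (z k - mxact P (y k)))) /\
           strong_cvg ip (fun k => mxact (S *m U) (z k - mxact P (y k))) 0,
         weak_cvg ip y ystar
       & weak_cvg ip z (mxact P ystar) /\ fixpts (T A) (mxact P ystar)]).
Proof.
move=> E W PQS.
have PhiSU (zz : 'I_d -> H) (v : 'I_n -> H) :
    pd_resolvent A p (S *m U *m P) (mxact (S *m U) zz) v <->
    Phi_op A p v (mxact (S *m U) (zz - mxact P v)).
  by rewrite pd_resolventP (raddfB (mxact (S *m U)))/= (mxactM (S *m U)).
have yP k : Phi_op A p (y k) (mxact (S *m U) (z k - mxact P (y k))).
  by apply/PhiSU; rewrite y_def.
have fejer k ybar : zer (Phi_op A p) ybar ->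
    wnorm2 ip Q (z k.+1 - mxact P ybar)
      <= wnorm2 ip Q (z k - mxact P ybar) - wnorm2 ip W (z k - mxact P (y k)).
  move=> y0; rewrite z_def.
  by apply: (fejer_step H_hilbert beta_gt0 A_coco p_notin_F Q_sym PQS) => //; exact: yP.
split=> // Qpos Wpos.
pose x k := z k - mxact P (y k).
have [cQ cQ0 Qcoer] := posdef_coercive H_hilbert Qpos.
have [cW cW0 Wcoer] := posdef_coercive H_hilbert Wpos.
have descent ybar : zer (Phi_op A p) ybar ->
    cvgn (fun k => wnorm2 ip Q (z k - mxact P ybar)) /\
    wnorm2 ip W (x k) @[k --> \oo] --> 0.
  move=> y0; apply: descent_cvg => k; [exact: fejer | |]; exact: posdef_wnorm2_ge0.
have [ybar ybar0] := zer_Phi_op p A_zer.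
have x0 : sum_ip ip (x k) (x k) @[k --> \oo] --> 0.
  apply: (@squeeze_cvgr _ _ _ _ (cst 0) (fun k => cW * wnorm2 ip W (x k))).
  - by apply: nearW => k; rewrite dot_ge0 Wcoer.
  - exact: cvg_cst.
  - by rewrite -(mulr0 cW); apply: cvgMr; exact: (descent _ ybar0).2.
have SUx0 : sum_ip ip (mxact (S *m U) (x k)) (mxact (S *m U) (x k)) @[k --> \oo] --> 0.
  exact: sum_ip_mxact_cvg0.
(* z is bounded by the descent of its distance to P ybar, then y by the Lipschitz
   property of the resolvent *)
have [C yC] : exists C : R, forall k i, `|y k i| <= C.
  have [cS cS0 SUb] := mxact_bounded H_hilbert (S *m U).
  have [c c0 cP] :=
    pd_resolvent_bounded A_coco p_notin_F beta_gt0 SUP_kernel H_hilbert.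
  pose N := Num.sqrt (cS * (cQ * wnorm2 ip Q (z 0%N - mxact P ybar))).
  have zb k : wnorm2 ip Q (z k - mxact P ybar) <= wnorm2 ip Q (z 0%N - mxact P ybar).
    elim: k => // k; apply: le_trans; apply: le_trans (fejer k _ ybar0) _.
    by rewrite lerBlDr lerDl posdef_wnorm2_ge0.
  have wN k i : `|mxact (S *m U) (z k) i - mxact (S *m U) (mxact P ybar) i| <= N.
    have -> : mxact (S *m U) (z k) i - mxact (S *m U) (mxact P ybar) i
        = mxact (S *m U) (z k - mxact P ybar) i.
      by rewrite (raddfB (mxact (S *m U))).
    apply: le_trans (norm_coord_le H_hilbert _ _) _; apply: ler_wsqrtr.
    apply: le_trans (SUb _) _; apply: ler_wpM2l => //.
    by apply: le_trans (Qcoer _) _; apply: ler_wpM2l.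
  exists (\sum_j `|ybar j| + c * N) => k i.
  rewrite -[y k i](subrK (ybar i)) addrC.
  apply: le_trans (ler_normD _ _) _; apply: lerD.
    by rewrite (bigD1 i)//= lerDl sumr_ge0.
  apply: cP (wN k) i.
    by apply/pd_resolventP; rewrite y_def.
  by apply/pd_resolventP/PhiSU; rewrite subrr raddf0.
have yC2 k : sum_ip ip (y k) (y k) <= n%:R * C ^+ 2.
  rewrite mulr_natl -[X in _ *+ X]card_ord -sumr_const; apply: ler_sum => i _.
  rewrite -H_hilbert ler_pXn2r ?nnegrE//.
  by apply: le_trans (yC k i).
(* z k = x k + P (y k) and x k tends to 0 *)
have zweak (G : set_system nat) (GF : ProperFilter G) ys : \oo `<=` G ->
    (forall w, sum_ip ip (y k) w @[k --> G] --> sum_ip ip ys w) ->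
    forall w, sum_ip ip (z k) w @[k --> G] --> sum_ip ip (mxact P ys) w.
  move=> ooG yw w.
  rewrite (_ : (fun k => _) = fun k => sum_ip ip (x k) w + sum_ip ip (y k) (mxact P^T w)).
    rewrite sum_ip_mxact -[X in _ --> X]add0r; apply: cvgD => //.
    apply: (@sum_ip_cvg0 _ _ ip _ _ _ _ (fun=> w) (sum_ip ip w w)) => //.
    by apply: cvg_trans x0; exact: cvg_app.
  apply/funext => k; rewrite -sum_ip_mxact -[RHS]dotDl/=.
  by rewrite /x subrK.
have cluster (G : set_system nat) : UltraFilter G -> \oo `<=` G ->
    exists2 ys, zer (Phi_op A p) ys &
      forall w, sum_ip ip (y k) w @[k --> G] --> sum_ip ip ys w.
  move=> GU ooG; have [ys ysw] := ultra_weak_cvg_tuple H_hilbert GU yC.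
  exists ys => //; apply: (weak_limit_zer beta_gt0 A_coco p_notin_F _ yP yC2 _ ysw).
  by apply: cvg_trans SUx0; exact: cvg_app.
(* both tuples are the value at P a = P b of the single-valued resolvent *)
have resolvent_unique (a b : 'I_n -> H) : zer (Phi_op A p) a ->
    zer (Phi_op A p) b -> mxact P a = mxact P b -> a = b.
  move=> a0 b0 Pab; have [v vE _] := T_repr A (mxact P a).
  have -> : a = v.
    by apply/(_ : [set v] a); rewrite -vE; apply/PhiSU; rewrite subrr raddf0.
  apply/esym/(_ : [set v] b); rewrite -vE; apply/PhiSU.
  by rewrite Pab subrr raddf0.
(* any ultrafilter yields a candidate; the others are shown to give the same one *)
have [G0 [G0U ooG0]] := ultraFilterLemma (_ : ProperFilter (\oo : set_system nat)).
have [ys ys0 ysw] := cluster _ G0U ooG0.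
have yweak : weak_cvg ip y ys.
  move=> w; apply: cvg_ultra => G GU ooG.
  have [b b0 bw] := cluster _ GU ooG.
  suff -> : ys = b by exact: bw.
  apply: resolvent_unique => //.
  apply: (opial_unique H_hilbert Q_sym _ _ Qpos ooG0 ooG).
  - exact: (descent _ ys0).1.
  - exact: (descent _ b0).1.
  - exact: zweak.
  - exact: zweak.
exists ys; split=> //.
- exact: strong_cvg0.
- by split=> //; exact: strong_cvg0.
split; first by move=> w; apply: zweak.
have [v vE TE] := T_repr A (mxact P ys).
have ysv : ys = v.
  by apply/(_ : [set v] ys); rewrite -vE; apply/PhiSU; rewrite subrr raddf0.
by rewrite /fixpts/= TE -ysv mxactM subrK.
Qed.
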